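(* Consider the following branch-and-bound algorithm, whose input is a polynomial $p\in\mathbb{R}[x_1,\dots,x_n]$ given in sparse form, and which uses a fixed accuracy $\varepsilon>0$ and the subroutines $\mathrm{LB}$ and $\mathrm{LocMin}$ described in the context. 1. Compute $\mathrm{LB}(p_{\mathbf 0})$ and $\mathrm{LocMin}(p_{\mathbf 0})$. Let $\mu$ be the function value returned by $\mathrm{LocMin}(p_{\mathbf 0})$. Initialise the search tree as the single root node $\mathbf 0\in\{-1,0,1\}^n$, and put $\mathrm{active}=\{\mathbf 0\}$. 2. While $\mathrm{active}\neq\emptyset$: (a) choose $\mathbf s\in\mathrm{active}$ with $\mathrm{LB}(p_{\mathbf s})$ minimal among all active nodes, and remove it from $\mathrm{active}$; (b) if $\mathrm{LB}(p_{\mathbf s})\ge \mu-\varepsilon$, or if $\mathbf s\in\{-1,1\}^n$, stop and return $\min\{\mathrm{LB}(p_{\mathbf l}) : \mathbf l \text{ is a leaf of the current search tree}\}$; (c) otherwise pick an index $i$ with $s_i=0$, let $\mathbf s^{+}$ and $\mathbf s^{-}$ be obtained from $\mathbf s$ by setting the $i$-th entry to $1$ and to $-1$ respectively, and append $\mathbf s^+,\mathbf s^-$ as the two children of $\mathbf s$ in the search tree; compute $\mathrm{LB}$ and $\mathrm{LocMin}$ for $p_{\mathbf s^+}$ and $p_{\mathbf s^-}$; replace $\mu$ by the smallest function value found so far; add $\mathbf s^+,\mathbf s^-$ to $\mathrm{active}$. Then for every input $p$ the algorithm terminates and returns a lower bound for $p$ on $\mathbb{R}^n$ (a value $\le\inf_{\mathbf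 x\in\mathbb{R}^n}p(\mathbf x)$). Moreover, its running time is fixed-parameter tractable in the number of variables $n$: there are a computable function $f:\mathbb{N}\to\mathbb{N}$ and a constant $c$ such that on every input $p$ in $n$ variables of encoding length $L$ the running time is $\mathcal{O}(f(n)\cdot L^{c})$.
   Context: A polynomial $p=\sum_{\boldsymbol\alpha\in A}b_{\boldsymbol\alpha}\mathbf x^{\boldsymbol\alpha}$ is given in sparse form by listing its finite support $A\subset\mathbb{N}^n$ and its nonzero coefficients; $L\ge n$ denotes the encoding length of this list. A sign vector is $\mathbf s\in\{-1,0,1\}^n$; its sign cone is $C_{\mathbf s}=\{\mathbf x\in\mathbb{R}^n : x_is_i\ge 0 \text{ for all } i=1,\dots,n\}$, so $C_{\mathbf 0}=\mathbb{R}^n$. $p_{\mathbf s}$ denotes $p$ restricted to the domain $C_{\mathbf s}$. Subroutines. $\mathrm{LB}(p_{\mathbf s})$ returns a rational number or $-\infty$ with $\mathrm{LB}(p_{\mathbf s})\le\inf_{\mathbf x\in C_{\mathbf s}}p(\mathbf x)$ (in the source: the best lower bound obtained from the nonnegativity certificates SONC and SAGE). If $\mathbf s'$ is a child of $\mathbf s$ in the search tree, then $\mathrm{LB}(p_{\mathbf s'})\ge\mathrm{LB}(p_{\mathbf s})$. $\mathrm{LocMin}(p_{\mathbf s})$ returns a point $\mathbf m\in\mathbb{R}^n$ together with the rational function value $p(\mathbf m)$ (in the source: a local minimisation heuristic). Both subroutines, applied to $p$ and any $\mathbf s\in\{-1,0,1\}^n$, run in time polynomial in $L$ (with $\varepsilon$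 fixed). *)

(* Defs.v *)
From mathcomp Require Import all_boot all_order all_algebra.
From mathcomp Require Import classical_sets reals constructive_ereal ereal.
(* The notations of mpoly clash with those of the analysis libraries. *)
From mathcomp Require Import -(notations) mpoly.

Set Implicit Arguments.
Unset Strict Implicit.
Unset Printing Implicit Defensive.

Import Order.TTheory GRing.Theory Num.Theory.

Local Open Scope nat_scope.

(** * Computable functions (Kleene's mu-recursive functions) *)

Inductive rfun : Type :=
  | RZero
  | RSucc
  | RProj of nat
  | RComp of rfun & seq rfun
  | RRec of rfun & rfun
  | RMin of rfun.

(* [reval g xs y]: the partial function denoted by [g] is defined at the
   argument list [xs], with value [y]. *)
Inductive reval : rfun -> seq nat -> nat -> Prop :=
  | reval_zero xs : reval RZero xs 0
  | reval_succ x xs : reval RSucc (x :: xs) x.+1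
  | reval_proj i xs : i < size xs -> reval (RProj i) xs (nth 0 xs i)
  | reval_comp g hs xs ys z :
      revals hs xs ys -> reval g ys z -> reval (RComp g hs) xs z
  | reval_rec0 g h xs y : reval g xs y -> reval (RRec g h) (0 :: xs) y
  | reval_recS g h k xs y z :
      reval (RRec g h) (k :: xs) y -> reval h (k :: y :: xs) z ->
      reval (RRec g h) (k.+1 :: xs) z
  | reval_min g xs y :
      reval g (y :: xs) 0 ->
      (forall z, z < y -> exists k, reval g (z :: xs) k.+1) ->
      reval (RMin g) xs y
with revals : seq rfun -> seq nat -> seq nat -> Prop :=
  | revals_nil xs : revals [::] xs [::]
  | revals_cons g gs xs y ys :
      reval g xs y -> revals gs xs ys -> revals (g :: gs) xs (y :: ys).

Definition computable (f : nat -> nat) : Prop :=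
  exists g : rfun, forall k, reval g [:: k] (f k).

(** * Encoding lengths *)

Definition bitlen (m : nat) : nat := (trunc_log 2 m).+1.

(* sign, numerator and denominator *)
Definition rat_size (q : rat) : nat :=
  (bitlen `|numq q|%N + bitlen `|denq q|%N).+1.

Definition erat_size (v : \bar rat) : nat :=
  if v is EFin q then rat_size q else 1.

Section Polynomials.
Variables (R : realType) (K : {pred R}) (csize : R -> nat) (n : nat).
Implicit Type p : mpoly.mpoly n R.

(* Real numbers have no finite encoding in general: [K] is the set of reals
   that may occur as coefficients, e.g. the rationals, and [csize b] is the
   encoding length of [b \in K]. *)
Definition encodable p : Prop :=
  forall a, a \in mpoly.msupp p -> mpoly.mcoeff a p \in K.

(* Unary header giving the dimension (so that the length is at least [n], and
   positive even for [p = 0]), then the list of pairs (exponent vector,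
   coefficient), the exponents being written in binary. *)
Definition enc_length p : nat :=
  n.+1 + \sum_(a <- mpoly.msupp p)
           (\sum_(i < n) bitlen (a i) + csize (mpoly.mcoeff a p)).

End Polynomials.

(** * Sign vectors and sign cones *)

(* [None], [Some true] and [Some false] encode the signs 0, 1 and -1. *)
Definition signvec (n : nat) := {ffun 'I_n -> option bool}.

Definition sign_val (e : option bool) : int :=
  (if e is Some b then if b then 1 else -1 else 0)%R.

Definition signvec0 (n : nat) : signvec n := [ffun=> None].

Definition full (n : nat) (s : signvec n) : bool := [forall i, s i != None].

Definition set_sign (n : nat) (s : signvec n) (i : 'I_n) (b : bool) :
  signvec n := [ffun j => if j == i then Some b else s j].

Definition sign_cone (R : realType) (n : nat) (s : signvec n) :
  set ('I_n -> R) :=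
  [set x | forall i, (0 <= x i * (sign_val (s i))%:~R)%R]%classic.

(* The infimum of [p] over [A], in the extended reals. *)
Definition inf_on (R : realType) (n : nat) (p : mpoly.mpoly n R)
  (A : set ('I_n -> R)) : \bar R :=
  ereal_inf [set (mpoly.meval x p)%:E | x in A]%classic.

(** * Subroutines and their running times *)

(* [LB n p s] and [LocMin n p s] stand for LB(p_s) and LocMin(p_s). *)
Record subroutines (R : realType) := Subroutines {
  LB : forall n, mpoly.mpoly n R -> signvec n -> \bar rat;
  LocMin : forall n, mpoly.mpoly n R -> signvec n -> ('I_n -> R) * rat;
  LB_time : forall n, mpoly.mpoly n R -> signvec n -> nat;
  LocMin_time : forall n, mpoly.mpoly n R -> signvec n -> nat }.

(** * The branch-and-bound algorithm *)

(* A node of the search tree stores its sign vector together with the value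
   of LB computed when the node was created. *)
Notation node n := (signvec n * \bar rat)%type.

Inductive tree (n : nat) : Type :=
  | Leaf of node n
  | Branch of node n & tree n & tree n.

(* Append [c1] and [c2] as the two children of the leaf [x]. *)
Fixpoint grow (n : nat) (x c1 c2 : node n) (t : tree n) : tree n :=
  match t with
  | Leaf y => if y == x then Branch x (Leaf c1) (Leaf c2) else Leaf y
  | Branch y l r => Branch y (grow x c1 c2 l) (grow x c1 c2 r)
  end.

Fixpoint leaf_min (n : nat) (t : tree n) : \bar rat :=
  match t with
  | Leaf y => y.2
  | Branch _ l r => Order.min (leaf_min l) (leaf_min r)
  end.

(* Bit costs of the bookkeeping.  [prim N] is the time taken by one primitive
   operation (comparing, copying or writing) on data of bit length [N]; a sign
   vector has length [n]. *)
Section Bookkeeping.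
Variables (prim : nat -> nat) (n : nat).

Definition node_size (x : node n) : nat := n + erat_size x.2.

(* Linear scan for the least bound; [v] is the least one met so far. *)
Fixpoint scan_time (v : \bar rat) (act : seq (node n)) : nat :=
  if act is x :: act' then
    prim (erat_size v + erat_size x.2) + scan_time (Order.min v x.2) act'
  else 0.

Definition select_time (act : seq (node n)) : nat :=
  if act is x :: act' then prim (node_size x) + scan_time x.2 act' else 0.

Definition remove_time (x : node n) (act : seq (node n)) : nat :=
  \sum_(y <- act) prim (node_size y + node_size x).

(* Search for the leaf [x] through the whole tree. *)
Fixpoint find_time (x : node n) (t : tree n) : nat :=
  match t with
  | Leaf y => prim (node_size y + node_size x)
  | Branch y l r =>
      prim (node_size y + node_size x) + (find_time x l + find_time x r)
  end.

Fixpoint leaf_min_time (t : tree n) : nat :=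
  match t with
  | Leaf y => prim (erat_size y.2)
  | Branch _ l r =>
      leaf_min_time l + leaf_min_time r
      + prim (erat_size (leaf_min l) + erat_size (leaf_min r))
  end.

End Bookkeeping.

(* [Run t act mu]: about to enter the loop with search tree [t], list [act] of
   active nodes and least function value found so far [mu].
   [Return v]: stopped with output [v]. *)
Inductive state (n : nat) : Type :=
  | Start
  | Run of tree n & seq (node n) & rat
  | Return of \bar rat.
Arguments Start {n}.
Arguments Return {n}.

Section Algorithm.
Variables (R : realType) (eps : R) (S : subroutines R) (prim : nat -> nat).
Variables (n : nat) (p : mpoly.mpoly n R).

Definition node_of (s : signvec n) : node n := (s, LB S p s).

Definition min_active (act : seq (node n)) (x : node n) : Prop :=
  x \in act /\ forall y, y \in act -> (x.2 <= y.2)%E.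

Definition stop_test (mu : rat) (x : node n) : bool :=
  ((ratr mu - eps)%:E <= er_map ratr x.2)%E || full x.1.

(* Cost of testing whether the loop is to be entered, of selecting and removing
   the node [x], and of the stopping test ([eps] is fixed, hence not counted
   among the operands). *)
Definition head_time (act : seq (node n)) (mu : rat) (x : node n) : nat :=
  prim 1 + select_time prim act + remove_time prim x act
  + (prim (erat_size x.2 + rat_size mu) + prim n).

(* Cost of the two calls at a new node and of adding the node to the list of
   active nodes and to the tree. *)
Definition create_time (s : signvec n) : nat :=
  LB_time S p s + LocMin_time S p s
  + (prim (node_size (node_of s)) + prim (node_size (node_of s))).

(* [step st c st']: the algorithm may go from [st] to [st'] at cost [c].  The
   choices left open (ties in the selection, branching index) make it a
   relation; a state [Run t [::] mu] has no successor. *)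
Inductive step : state n -> nat -> state n -> Prop :=
  | step_init :
      let s0 := signvec0 n in
      step Start
        (create_time s0 + prim (rat_size (LocMin S p s0).2))
        (Run (Leaf (node_of s0)) [:: node_of s0] (LocMin S p s0).2)
  | step_stop t act mu x :
      min_active act x -> stop_test mu x ->
      step (Run t act mu)
        (head_time act mu x + leaf_min_time prim t)
        (Return (leaf_min t))
  | step_branch t act mu x i :
      min_active act x -> ~~ stop_test mu x -> x.1 i = None ->
      let sp := set_sign x.1 i true in
      let sm := set_sign x.1 i false in
      let vp := (LocMin S p sp).2 in
      let vm := (LocMin S p sm).2 in
      step (Run t act mu)
        (head_time act mu x
         + (prim n + prim n + prim n) (* finding i, forming sp and sm *)
         + (create_time sp + create_time sm + find_time prim x t)
         + (prim (rat_size vp + rat_size vm)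
            + prim (rat_size mu + rat_size (Order.min vp vm))))
        (Run (grow x (node_of sp) (node_of sm) t)
             [:: node_of sp, node_of sm & rem x act]
             (Order.min mu (Order.min vp vm))).

(* [exec st c st']: some finite execution from [st] to [st'] has total cost
   [c]. *)
Inductive exec : state n -> nat -> state n -> Prop :=
  | exec_refl st : exec st 0 st
  | exec_step st c st' c' st'' :
      step st c st' -> exec st' c' st'' -> exec st (c + c') st''.

(* Every execution from [Start] is finite, and can only end by returning a
   value that satisfies [Q]. *)
Definition terminates_with (Q : \bar rat -> Prop) : Prop :=
  Acc (fun st' st => exists c, step st c st') Start
  /\ forall c st, exec Start c st ->
       (exists v, st = Return v /\ Q v) \/ (exists c' st', step st c' st').

End Algorithm.

(* Main.v *)
Require Import Defs.
From mathcomp Require Import all_boot all_order all_algebra.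
From mathcomp Require Import classical_sets reals constructive_ereal ereal.
From mathcomp Require Import -(notations) mpoly.
From mathcomp Require Import zify.

(* Every full sign vector refines the sign vector of exactly one active node,
   and of exactly one leaf of the search tree.  Hence the cones of the leaves
   cover R^n, so that the returned value is a lower bound, and there are at most
   2^n leaves and at most 2^n active nodes.  Each branching adds one active node,
   so there are fewer than 2^n of them; each costs four subroutine calls and
   O(2^n) primitive operations on data of length polynomial in L.  The total time
   is thus O(4^n) times a polynomial in L. *)

Set Implicit Arguments.
Unset Strict Implicit.
Unset Printing Implicit Defensive.

Import Order.TTheory GRing.Theory Num.Theory.

(** * Computability of [4 ^ k] and monomial bounds for polynomials *)

Lemma computable_exp4 : computable (fun k => 4 ^ k).
Proof.
pose add := RRec (RProj 0) (RComp RSucc [:: RProj 1]).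
have addP a b : reval add [:: a; b] (a + b).
  elim: a => [|a IHa]; first by apply: reval_rec0; exact: reval_proj.
  apply: reval_recS IHa _; apply: reval_comp (reval_succ _ [::]).
  by apply: revals_cons (revals_nil _); exact: reval_proj.
pose dbl i := RComp add [:: RProj i; RProj i].
have dblP i xs : i < size xs -> reval (dbl i) xs (nth 0 xs i + nth 0 xs i).
  move=> lti; apply: reval_comp (addP _ _).
  by do 2?apply: revals_cons; [exact: reval_proj.. | exact: revals_nil].
(* The base value is 1; the step function receives the counter as argument 0 and the previous value
   as argument 1, which it doubles twice. *)
exists (RRec (RComp RSucc [:: RZero]) (RComp (dbl 0) [:: dbl 1])) => k.
elim: k => [|k IHk].
  apply: reval_rec0; apply: reval_comp (reval_succ _ [::]).
  by apply: revals_cons (revals_nil _); exact: reval_zero.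
apply: reval_recS IHk _.
have -> : 4 ^ k.+1 = 4 ^ k + 4 ^ k + (4 ^ k + 4 ^ k) by rewrite expnS; lia.
apply: reval_comp; last exact: (dblP 0 [:: _]).
by apply: revals_cons (revals_nil _); exact: (dblP 1 [:: k; 4 ^ k]).
Qed.

(** Coefficients in [nat] are nonnegative, so each [N ^ i] may be raised to [D ^ size P], leaving
    the sum of the coefficients as constant. Positivity of [D] makes its powers increase with the
    exponent. *)
Lemma leq_horner_monomial (P : {poly nat}) :
  exists c C : nat, forall N D : nat, N <= D -> 0 < D -> P.[N]%R <= C * D ^ c.
Proof.
exists (size P), (\sum_(i < size P) P`_i)%R => N D leND D_gt0.
rewrite horner_coef.
rewrite (big_distrl _ _ _ : _ * _ = _) /=; apply: leq_sum => i _.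
rewrite natrXE; apply: leq_mul => //.
apply: leq_trans (_ : D ^ i <= _); first by case: (i : nat) => // j; rewrite leq_exp2r.
by rewrite leq_pexp2l // ltnW.
Qed.

Lemma le_er_map_ratr (R : realType) (u v : \bar rat) :
  (u <= v)%E -> ((er_map ratr u : \bar R) <= er_map ratr v)%E.
Proof.
case: u v => [u| |] [v| |] //=; rewrite ?leey ?leNye //.
by rewrite !lee_fin ler_rat.
Qed.

(** * Search trees and exact covers by sign vectors *)

Section Trees.
Variable n : nat.
Implicit Types (s : signvec n) (x y : node n) (t : tree n).

Fixpoint leaves t : seq (node n) :=
  match t with
  | Leaf y => [:: y]
  | Branch _ l r => leaves l ++ leaves r
  end.

Fixpoint nodes t : seq (node n) :=
  match t with
  | Leaf y => [:: y]
  | Branch y l r => y :: nodes l ++ nodes r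
  end.

Lemma size_nodes t : (size (nodes t)).+1 = (size (leaves t)).*2.
Proof. by elim: t => //= y l IHl r IHr; rewrite !size_cat doubleD; lia. Qed.

Lemma leaves_sub_nodes t : {subset leaves t <= nodes t}.
Proof.
elim: t => [y|y l IHl r IHr] z //=; rewrite mem_cat inE mem_cat.
by case/orP => [/IHl|/IHr] ->; rewrite !orbT.
Qed.

Lemma leaf_min_le t x : x \in leaves t -> (leaf_min t <= x.2)%E.
Proof.
elim: t => [y|y l IHl r IHr] /=; first by rewrite inE => /eqP ->.
by rewrite mem_cat ge_min => /orP[/IHl|/IHr] ->; rewrite ?orbT.
Qed.

Lemma leaf_min_attained t : exists2 x, x \in leaves t & leaf_min t = x.2.
Proof.
elim: t => [y|y l [a al ea] r [b br eb]] /=; first by exists y; rewrite ?inE.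
rewrite ea eb; case: leP => _.
  by exists a; rewrite // mem_cat al.
by exists b; rewrite // mem_cat br orbT.
Qed.

Lemma nodes_grow x c1 c2 t (P : pred (node n)) :
  P c1 -> P c2 -> all P (nodes t) -> all P (nodes (grow x c1 c2 t)).
Proof.
move=> P1 P2; elim: t => [y|y l IHl r IHr] /=; last first.
  by rewrite !all_cat => /and3P[-> /IHl -> /IHr ->].
by case: eqP => [<-|_] /=; rewrite ?P1 ?P2 ?andbT.
Qed.

(** The functions [g] stand for the [2 ^ n] full sign vectors, [true] being the sign 1. *)
Definition refines (g : {ffun 'I_n -> bool}) x : bool :=
  [forall i, (x.1 i == None) || (x.1 i == Some (g i))].

Definition exact_cover (e : seq (node n)) : Prop :=
  forall g, count (refines g) e = 1.

Lemma refines_signvec0 g v : refines g (signvec0 n, v).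
Proof. by apply/forallP => i; rewrite ffunE. Qed.

Lemma refines_set_sign g x i v w : x.1 i = None ->
  refines g (set_sign x.1 i true, v) + refines g (set_sign x.1 i false, w)
  = refines g x.
Proof.
move=> xi.
(* The sign [g i] selects exactly one of the two children. *)
have E b u : refines g (set_sign x.1 i b, u) = (g i == b) && refines g x.
  apply/forallP/andP => [gx|[/eqP <- /forallP gx] j]; last first.
    by rewrite ffunE; case: (eqVneq j i) => [->|_]; [rewrite eqxx orbT | exact: gx].
  split; first by have := gx i; rewrite ffunE eqxx /= eq_sym.
  apply/forallP => j; case: (eqVneq j i) => [->|ji]; first by rewrite xi.
  by have := gx j; rewrite ffunE (negbTE ji).
by rewrite !E; case: (g i); case: (refines g x).
Qed.

Lemma exact_cover_rem x c1 c2 e :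
  (forall g, refines g c1 + refines g c2 = refines g x) -> x \in e ->
  exact_cover e -> exact_cover [:: c1, c2 & rem x e].
Proof.
move=> E xe cov g; rewrite /= addnA E count_rem xe /= subnKC //.
by rewrite (seq.permP (perm_to_rem xe)) /= leq_addr.
Qed.

(** Replacing a leaf equal to [x] by [c1] and [c2] preserves the count for every [g], however many
    leaves [grow] replaces. *)
Lemma exact_cover_grow x c1 c2 t :
  (forall g, refines g c1 + refines g c2 = refines g x) ->
  exact_cover (leaves t) -> exact_cover (leaves (grow x c1 c2 t)).
Proof.
move=> E cov g; rewrite -(cov g).
elim: t {cov} => [y|y l IHl r IHr] /=; last by rewrite !count_cat IHl IHr.
by case: eqP => [->|//] /=; rewrite addn0 E addn0.
Qed.

Lemma exact_cover_gt0 e : exact_cover e -> 0 < size e.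
Proof. by move=> /(_ [ffun=> true]); case: e. Qed.

(** Double counting of the pairs [(g, x)] with [refines g x]: each [g] contributes exactly one, each
    [x] at least one. *)
Lemma exact_cover_size e : exact_cover e -> size e <= 2 ^ n.
Proof.
move=> cov.
have -> : 2 ^ n = \sum_(g : {ffun 'I_n -> bool}) \sum_(x <- e) refines g x.
  rewrite (eq_bigr (fun=> 1)) => [|g _]; last first.
    by rewrite -(cov g) -sum1_count [in RHS]big_mkcond.
  by rewrite sum1_card card_ffun card_bool card_ord.
rewrite exchange_big /= -sum1_size; apply: leq_sum => x _.
(* Filling the free signs of [x] with [true] gives a refinement. *)
by rewrite (bigD1 [ffun i => odflt true (x.1 i)]) //= /refines;
  rewrite (introT forallP) // => i; rewrite ffunE; case: (x.1 i) => //= b;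
  rewrite eqxx.
Qed.

(** The signs of [z], with zero counted as positive, form a full sign vector; the entry it refines
    has [z] in its cone, a free sign imposing no condition. *)
Lemma exact_cover_sign_cone (R : realType) e (z : 'I_n -> R) :
  exact_cover e -> exists2 x, x \in e & sign_cone x.1 z.
Proof.
move=> /(_ [ffun i => (0 <= z i)%R]) cov.
have /hasP[x xe /forallP xz] : has (refines [ffun i => (0 <= z i)%R]) e.
  by rewrite has_count cov.
exists x => // i; have := xz i; rewrite ffunE.
case: (x.1 i) => [b|] /=; last by rewrite mulr0.
case/eqP => ->; case: ifP => zi /=; rewrite ?mulr1 //.
by rewrite mulrN1 oppr_ge0 ltW // ltNge zi.
Qed.

End Trees.

Lemma min_active_exists n (act : seq (node n)) :
  0 < size act -> exists x, min_active act x.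
Proof.
elim: act => // y [|z act] IH _.
  by exists y; split=> [|w]; rewrite inE // => /eqP ->.
have [x [xa minx]] := IH isT; case: (leP y.2 x.2) => [yx|/ltW xy].
  exists y; split=> [|w]; first by rewrite inE eqxx.
  by rewrite inE => /predU1P[-> //|/minx]; exact: le_trans.
by exists x; split=> [|w]; rewrite inE ?xa ?orbT // => /predU1P[-> //|/minx].
Qed.

(** * Invariant, termination and correctness of a run *)

Section Run.
Variables (R : realType) (eps : R) (S : subroutines R) (prim : nat -> nat).
Variables (n : nat) (p : mpoly.mpoly n R).

Definition evaluated (x : node n) : bool := x == node_of S p x.1.

(** The loop invariant. Its condition on [mu] later bounds the bit length of [mu]. *)
Definition consistent (st : state n) : Prop :=
  match st with
  | Start => True
  | Run t act mu =>
      [/\ exact_cover act, exact_cover (leaves t), all evaluated act,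
          all evaluated (nodes t) & exists s, mu = (LocMin S p s).2]
  | Return v =>
      exists t, [/\ exact_cover (leaves t), all evaluated (nodes t)
                  & v = leaf_min t]
  end.

(** A termination measure: branching lengthens the active list by one, and an exact cover has at
    most [2 ^ n] entries. *)
Definition rank (st : state n) : nat :=
  match st with
  | Start => (2 ^ n).+1
  | Run _ act _ => (2 ^ n - size act).+1
  | Return _ => 0
  end.

Lemma evaluated_node_of s : evaluated (node_of S p s).
Proof. exact: eqxx. Qed.

Lemma locmin_min (u v : rat) :
  (exists s, u = (LocMin S p s).2) -> (exists s, v = (LocMin S p s).2) ->
  exists s, Order.min u v = (LocMin S p s).2.
Proof. by move=> [a ->] [b ->]; case: leP => _; [exists a | exists b]. Qed.

Lemma step_consistent st c st' :
  step eps S prim p st c st' -> consistent st -> consistent st'.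
Proof.
case=> [s0 _|t act mu x [xa _] _ [_ ? _ ? _]|t act mu x i [xa _] _ xi sp sm vp vm].
- by split; rewrite /= ?evaluated_node_of //; [move=> g /=; rewrite refines_signvec0..
  | exists s0].
- by exists t.
case=> coa cot eva evt emu.
have E g : refines g (node_of S p sp) + refines g (node_of S p sm) = refines g x.
  exact: refines_set_sign.
split.
- exact: exact_cover_rem.
- exact: exact_cover_grow.
- rewrite /= !evaluated_node_of /=; apply/allP => y /mem_rem.
  by move/(allP eva).
- by apply: nodes_grow; rewrite ?evaluated_node_of.
- by apply: locmin_min => //; apply: locmin_min; [exists sp | exists sm].
Qed.

Lemma step_rank st c st' :
  step eps S prim p st c st' -> consistent st -> rank st' < rank st.
Proof.
move=> stp cst; have := step_consistent stp cst.
case: stp cst => [s0 _ _|//|].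
  by have : 0 < 2 ^ n; [rewrite expn_gt0 | rewrite /=; lia].
(* Consistency of the state reached bounds its longer active list by [2 ^ n], so the truncated
   subtraction strictly decreases. *)
move=> t act mu x i [xa _] _ _ sp sm vp vm _ [/exact_cover_size + _ _ _ _].
have act_gt0 : 0 < size act by case: (act) xa.
by rewrite /= size_rem // prednK // ltnS => lt_act; rewrite ltn_sub2l.
Qed.

Lemma exec_consistent st c st' :
  exec eps S prim p st c st' -> consistent st -> consistent st'.
Proof.
by elim=> // {}st {}c st1 c' {}st' stp _ IH cst; apply/IH/(step_consistent stp).
Qed.

Lemma step_acc st : consistent st ->
  Acc (fun st' st0 => exists c, step eps S prim p st0 c st') st.
Proof.
have [k] := ubnP (rank st); elim: k st => [//|k IH] st lek cst.
constructor=> st' [c stp]; apply: IH (step_consistent stp cst).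
exact: leq_trans (step_rank stp cst) lek.
Qed.

(** An exact cover is nonempty, so the loop never runs out of active nodes; a node failing the
    stopping test has a free sign to branch on. *)
Lemma consistent_progress st : consistent st ->
  (exists v, st = Return v) \/ exists c st', step eps S prim p st c st'.
Proof.
case: st => [_|t act mu [coa _ _ _ _]|v _]; last by left; exists v.
  by right; do 2!eexists; exact: step_init.
right; have [x minx] := min_active_exists (exact_cover_gt0 coa).
case stopx: (stop_test eps mu x).
  by do 2!eexists; apply: step_stop minx stopx.
have /existsP[i /negPn/eqP xi] : [exists i, ~~ (x.1 i != None)].
  rewrite -negb_forall; apply/negP => fullx.
  by move: stopx; rewrite /stop_test /full fullx orbT.
by do 2!eexists; apply: step_branch minx _ xi; rewrite stopx.
Qed.

(** Each point lies in the cone of some leaf, whose stored bound is sound there and at least the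
    returned minimum. *)
Lemma consistent_return v :
  (forall s, (er_map ratr (LB S p s) <= inf_on p (sign_cone s))%E) ->
  consistent (Return v) ->
  (er_map ratr v <= inf_on p [set: 'I_n -> R]%classic)%E.
Proof.
move=> sound [t [cot evt ->]]; apply/ereal_infP => _ [z _ <-].
have [x xt xz] := exact_cover_sign_cone z cot.
have /eqP ex := allP evt _ (leaves_sub_nodes xt).
apply: (@le_trans _ _ (er_map ratr x.2)).
  exact: le_er_map_ratr (leaf_min_le xt).
rewrite {1}ex; apply: le_trans (sound _) _.
by apply: ereal_inf_lbound; exists z.
Qed.

(** * Cost of a run, in terms of a data length [d] and a unit time [B] *)

Variables d B : nat.
Hypothesis d_gt0 : 0 < d.
Hypothesis node_size_le : forall s, node_size (node_of S p s) <= d.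
Hypothesis rat_size_le : forall s, rat_size (LocMin S p s).2 <= d.
Hypothesis LB_time_le : forall s, LB_time S p s <= B.
Hypothesis LocMin_time_le : forall s, LocMin_time S p s <= B.
(** A primitive operation handles at most two operands of length [d]. *)
Hypothesis prim_le : forall m, m <= d.*2 -> prim m <= B.

Lemma evaluated_size x : evaluated x -> node_size x <= d.
Proof. by move/eqP ->. Qed.

Lemma evaluated_erat_size x : evaluated x -> erat_size x.2 <= d.
Proof. by move/evaluated_size; apply: leq_trans; rewrite leq_addl. Qed.

Lemma scan_time_le v act : erat_size v <= d -> all evaluated act ->
  scan_time prim v act <= size act * B.
Proof.
elim: act v => //= x act IH v lev /andP[/evaluated_erat_size lex eva].
rewrite mulSn leq_add //; first by apply: prim_le; lia.
by apply: IH => //; case: leP.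
Qed.

Lemma select_time_le act : all evaluated act ->
  select_time prim act <= size act * B.
Proof.
case: act => //= x act /andP[evx eva]; rewrite mulSn leq_add //.
  by apply: prim_le; have := evaluated_size evx; lia.
exact: scan_time_le (evaluated_erat_size evx) eva.
Qed.

Lemma sum_prim_le x (e : seq (node n)) : evaluated x -> all evaluated e ->
  \sum_(y <- e) prim (node_size y + node_size x) <= size e * B.
Proof.
move=> evx /allP eve; rewrite -sum1_size big_distrl /= big_seq [leqRHS]big_seq.
apply: leq_sum => y /eve evy; rewrite mul1n; apply: prim_le.
by have := evaluated_size evx; have := evaluated_size evy; lia.
Qed.

Lemma find_time_sum (x : node n) t :
  find_time prim x t = \sum_(y <- nodes t) prim (node_size y + node_size x).
Proof.
elim: t => [y|y l IHl r IHr] /=; first by rewrite big_seq1.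
by rewrite big_cons big_cat /= IHl IHr.
Qed.

Lemma leaf_min_time_le t : all evaluated (nodes t) ->
  leaf_min_time prim t <= size (nodes t) * B.
Proof.
(* The minimum over a subtree is the bound of one of its leaves, so intermediate results do not
   grow. *)
have min_size u : all evaluated (nodes u) -> erat_size (leaf_min u) <= d.
  move=> /allP evu; have [x xu ->] := leaf_min_attained u.
  exact/evaluated_erat_size/evu/leaves_sub_nodes.
elim: t => [y|y l IHl r IHr] /=.
  rewrite andbT mul1n => /evaluated_erat_size ley; apply: prim_le; lia.
case/andP=> _; rewrite all_cat => /andP[evl evr].
rewrite size_cat mulSn mulnDl addnC leq_add //; last first.
  by rewrite leq_add ?IHl ?IHr.
by apply: prim_le; have := min_size _ evl; have := min_size _ evr; lia.
Qed.

Lemma dim_le : n <= d.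
Proof. by apply: leq_trans (node_size_le (signvec0 n)); rewrite leq_addr. Qed.

Lemma create_time_le s : create_time S prim p s <= 4 * B.
Proof.
have prim_node : prim (node_size (node_of S p s)) <= B.
  by apply: prim_le; have := node_size_le s; lia.
by rewrite /create_time; have := LB_time_le s; have := LocMin_time_le s; lia.
Qed.

(** In units of [B], initialisation costs at most 5, stopping 3 + 4 [2 ^ n], and branching 16 + 4
    [2 ^ n]; all are within 21 [2 ^ n]. *)
Lemma step_cost st c st' : consistent st -> step eps S prim p st c st' ->
  c <= 21 * 2 ^ n * B.
Proof.
have pow_gt0 : 0 < 2 ^ n by rewrite expn_gt0.
have primn : prim n <= B by apply: prim_le; have := dim_le; lia.
have head t act mu x : consistent (Run t act mu) -> min_active act x ->
  [/\ head_time prim act mu x <= (3 + 2 * 2 ^ n) * B, evaluated x,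
      size (nodes t) <= 2 * 2 ^ n, all evaluated (nodes t) & rat_size mu <= d].
  case=> coa cot eva evt [s emu] [xa _]; have evx := allP eva _ xa.
  have lemu : rat_size mu <= d by rewrite emu.
  have leact := exact_cover_size coa.
  split=> //; last first.
    by have := size_nodes t; have := exact_cover_size cot; lia.
  have prim1 : prim 1 <= B by apply: prim_le; lia.
  have primx : prim (erat_size x.2 + rat_size mu) <= B.
    by apply: prim_le; have := evaluated_erat_size evx; lia.
  have := select_time_le eva; have := sum_prim_le evx eva.
  have : size act * B <= 2 ^ n * B by rewrite leq_mul.
  by rewrite /head_time /remove_time; lia.
move=> cst stp; case: stp cst => {st c st'}.
- move=> s0 _; have primm : prim (rat_size (LocMin S p s0).2) <= B.
    by apply: prim_le; have := rat_size_le s0; lia.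
  have : 1 * B <= 2 ^ n * B by rewrite leq_mul.
  by have := create_time_le s0; lia.
- move=> t act mu x minx _ cst; have [hd _ szt evt _] := head _ _ _ _ cst minx.
  have : 1 * B <= 2 ^ n * B by rewrite leq_mul.
  have : size (nodes t) * B <= 2 * 2 ^ n * B by rewrite leq_mul.
  by have := leaf_min_time_le evt; lia.
move=> t act mu x i minx _ xi sp sm vp vm cst.
have [hd evx szt evt lemu] := head _ _ _ _ cst minx.
have levp : rat_size vp <= d by exact: rat_size_le.
have levm : rat_size vm <= d by exact: rat_size_le.
have primv : prim (rat_size vp + rat_size vm) <= B by apply: prim_le; lia.
have primu : prim (rat_size mu + rat_size (Order.min vp vm)) <= B.
  by apply: prim_le; case: leP => _; lia.
have := sum_prim_le evx evt; rewrite -find_time_sum => find_le.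
have : 1 * B <= 2 ^ n * B by rewrite leq_mul.
have : size (nodes t) * B <= 2 * 2 ^ n * B by rewrite leq_mul.
by have := create_time_le sp; have := create_time_le sm; lia.
Qed.

(** Every step lowers the rank, so there are at most [rank st] steps. *)
Lemma exec_cost st c st' : exec eps S prim p st c st' -> consistent st ->
  c <= rank st * (21 * 2 ^ n * B).
Proof.
elim=> // {}st {}c st1 c' {}st' stp _ IH cst.
have cst1 := step_consistent stp cst.
apply: leq_trans (leq_add (step_cost cst stp) (IH cst1)) _.
by rewrite -mulSn leq_mul // (step_rank stp cst).
Qed.

End Run.
Theorem mainTheorem1
  (R : realType)
  (* coefficients and their encoding lengths *)
  (K : {pred R}) (csize : R -> nat)
  (eps : R) (eps_gt0 : (0 < eps)%R)
  (S : subroutines R) (prim : nat -> nat)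
  (* specification of LB *)
  (LB_fin : forall n (p : mpoly.mpoly n R) (s : signvec n),
     encodable K p -> LB S p s <> +oo%E)
  (LB_sound : forall n (p : mpoly.mpoly n R) (s : signvec n),
     encodable K p ->
     (er_map ratr (LB S p s) <= inf_on p (sign_cone s))%E)
  (LB_mono : forall n (p : mpoly.mpoly n R) (s : signvec n) (i : 'I_n) b,
     encodable K p -> s i = None ->
     (LB S p s <= LB S p (set_sign s i b))%E)
  (* specification of LocMin *)
  (LocMin_val : forall n (p : mpoly.mpoly n R) (s : signvec n),
     encodable K p ->
     ratr (LocMin S p s).2 = mpoly.meval (LocMin S p s).1 p)
  (* the subroutines run in polynomial time *)
  (LB_poly : exists P : {poly nat},
     forall n (p : mpoly.mpoly n R) (s : signvec n), encodable K p ->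
     (LB_time S p s <= P.[enc_length csize p]%R)%N)
  (LocMin_poly : exists P : {poly nat},
     forall n (p : mpoly.mpoly n R) (s : signvec n), encodable K p ->
     (LocMin_time S p s <= P.[enc_length csize p]%R)%N)
  (* writing down an output takes at least as long as its length *)
  (LB_write : forall n (p : mpoly.mpoly n R) (s : signvec n),
     encodable K p -> (erat_size (LB S p s) <= LB_time S p s)%N)
  (LocMin_write : forall n (p : mpoly.mpoly n R) (s : signvec n),
     encodable K p -> (rat_size (LocMin S p s).2 <= LocMin_time S p s)%N)
  (* primitive bookkeeping operations take time polynomial in the bit length *)
  (prim_poly : exists P : {poly nat}, forall N : nat, (prim N <= P.[N]%R)%N) :
  (forall n (p : mpoly.mpoly n R), encodable K p ->
     terminates_with eps S prim p
       (fun v => (er_map ratr v <= inf_on p [set: 'I_n -> R]%classic)%E))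
  /\
  (exists f : nat -> nat, computable f /\ exists c C : nat,
     forall n (p : mpoly.mpoly n R) (T : nat) (st : state n),
       encodable K p -> exec eps S prim p Start T st ->
       (T <= C * (f n * enc_length csize p ^ c))%N).
Proof.
split=> [n p encp|].
  split=> [|c st run]; first exact: step_acc.
  have cst := exec_consistent run I.
  have [[v ev]|] := consistent_progress eps prim cst; last by right.
  left; exists v; split=> //; move: cst; rewrite ev; apply: consistent_return.
  by move=> s; exact: LB_sound.
exists (fun k => 4 ^ k); split; first exact: computable_exp4.
have [P1 LB_le] := LB_poly; have [P2 LM_le] := LocMin_poly.
have [P3 prim_le] := prim_poly.
have [c1 [C1 P1_le]] := leq_horner_monomial P1.
have [c2 [C2 P2_le]] := leq_horner_monomial P2.
have [c3 [C3 P3_le]] := leq_horner_monomial P3.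
(* [e] dominates [c1], [c2] and 1; the summand 1 of [D] absorbs the length [n] of a sign vector. *)
pose e := (c1 + c2).+1; pose D := C1 + C2 + 1.
exists (e * c3.+1)%N, (42 * ((C3.+1) * (2 * D) ^ c3.+1))%N => n p T st encp run.
set L := enc_length csize p.
have ltnL : n < L by rewrite /L /enc_length ltnS leq_addr.
have L_gt0 : 0 < L by apply: leq_ltn_trans ltnL.
have mono c : c <= e -> L ^ c <= L ^ e by move=> ce; rewrite leq_pexp2l.
pose d := D * L ^ e.
have LBt s : LB_time S p s <= C1 * L ^ e.
  apply: leq_trans (LB_le _ _ s encp) _; apply: leq_trans (P1_le _ L _ _) _ => //.
  by rewrite leq_mul // mono // /e; lia.
have LMt s : LocMin_time S p s <= C2 * L ^ e.
  apply: leq_trans (LM_le _ _ s encp) _; apply: leq_trans (P2_le _ L _ _) _ => //.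
  by rewrite leq_mul // mono // /e; lia.
have Le : L <= L ^ e by have := mono 1; rewrite expn1; apply.
have dE : d = C1 * L ^ e + C2 * L ^ e + L ^ e by rewrite /d /D !mulnDl mul1n.
(* The successors make the factor and the exponent positive, so that [B] also dominates [d], hence
   the subroutine times. *)
pose B := C3.+1 * d.*2 ^ c3.+1.
have d_gt0 : 0 < d by lia.
have dB : d <= B.
  rewrite /B -[d]mul1n leq_mul // mul1n; apply: leq_trans (_ : d.*2 ^ 1 <= _).
    by rewrite expn1; lia.
  by rewrite leq_pexp2l //; lia.
have primB m : m <= d.*2 -> prim m <= B.
  move=> lem; apply: leq_trans (prim_le m) _.
  apply: leq_trans (P3_le _ d.*2 lem _) _; first by lia.
  by rewrite /B leq_mul // leq_pexp2l //; lia.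
apply: leq_trans (exec_cost (d := d) (B := B) _ _ _ _ _ primB run I) _.
- exact: d_gt0.
- by move=> s; have := LB_write _ _ s encp; have := LBt s; rewrite /node_size /=; lia.
- by move=> s; have := LocMin_write _ _ s encp; have := LMt s; lia.
- by move=> s; have := LBt s; lia.
- by move=> s; have := LMt s; lia.
have -> : B = C3.+1 * (2 * D) ^ c3.+1 * L ^ (e * c3.+1).
  by rewrite /B /d -mul2n (mulnA 2) [in LHS]expnMn expnM mulnA.
have -> : 4 ^ n = 2 ^ n * 2 ^ n by rewrite (expnMn 2 2).
rewrite /= -/L.
set Q := C3.+1 * _; set M := L ^ _; set q := 2 ^ n.
have q_gt0 : 0 < q by rewrite expn_gt0.
(* The rank of [Start] is [q.+1]; bounding it by [2 * q] yields the constant 42 = 2 · 21 and the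
   factor [q * q], that is [4 ^ n]. *)
have : q.+1 <= 2 * q by lia.
move=> leq2; apply: leq_trans (_ : 2 * q * (21 * q * (Q * M)) <= _).
  by rewrite leq_mul.
by apply/eq_leq; lia.
Qed.
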